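(* Let $\Delta$ be the Sylvester simplex of dimension $15$. Then $P_{5,1}=5\Delta\cap[-1,1]^{15}$ is integral in $\Lambda_1=(1+2\mathbb Z)^{15}$ (all its vertices lie in $\Lambda_1$), and $P_{5,1}$ is not normal.
   Context: The Sylvester matrix of order $N=16$ has rows and columns indexed by $\mathbb F_2^4$ and entries $(-1)^{r\cdot j}$ (dot product over $\mathbb F_2$) in row $r$, column $j$. Deleting the all-ones column $j=0$ leaves rows $v_r\in\{\pm1\}^{15}$, $r\in\mathbb F_2^4$, with coordinates indexed by the nonzero $j$. The Sylvester simplex of dimension $15$ is $\Delta=\operatorname{conv}\{v_r\}=\{x\in\mathbb R^{15}: v_r\cdot x\ge-1\ \forall r\}$. With $d=15$, for positive odd $n<m<dn$ put $P_{m,n}=m\Delta\cap[-n,n]^d$ and $\Lambda_n=(n+2\mathbb Z)^d$. $P_{m,n}$ is normal if, for every integer $k\ge1$, every point of $kP_{m,n}\cap(kn+2\mathbb Z)^d$ is a sum of $k$ points of $P_{m,n}\cap\Lambda_n$. (Equivalently, $Q_{m,n}=(P_{m,n}+n\mathbf 1)/2$ has the property that every $Z\in kQ_{m,n}\cap\mathbb Z^d$ is a sum of $k$ points of $Q_{m,n}\cap\mathbb Z^d$ for all $k\ge 1$.) *)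

(* Defs.v *)
From mathcomp Require Import all_boot all_order all_algebra.
From mathcomp Require Import classical_sets reals.

Import Order.TTheory GRing.Theory Num.Theory.
Local Open Scope classical_set_scope.
Local Open Scope ring_scope.

(* The 15 coordinates are indexed by the nonzero j in F_2^4. *)
Notation index15 := {j : 'rV['F_2]_4 | j != 0}.

(* The space R^15; the regular module R^o gives it its lmodType structure. *)
Notation space15 R := {ffun index15 -> R^o}.

Definition dotF2 (r j : 'rV['F_2]_4) : 'F_2 := \sum_(i < 4) r 0 i * j 0 i.

Definition sylvester (R : realType) (r j : 'rV['F_2]_4) : R :=
  (-1) ^+ nat_of_ord (dotF2 r j).

Definition sylvester_row (R : realType) (r : 'rV['F_2]_4) : space15 R :=
  [ffun j : index15 => sylvester R r (val j)].

Definition conv {R : realType} {V : lmodType R} {I : finType} (v : I -> V) :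
    set V :=
  [set x | exists a : I -> R,
     [/\ forall i, 0 <= a i, \sum_i a i = 1 & x = \sum_i a i *: v i]].

Definition dilate {R : realType} {V : lmodType R} (c : R) (A : set V) : set V :=
  [set c *: x | x in A].

(* The vertices of a polytope, as its extreme points. *)
Definition vertices {R : realType} {V : lmodType R} (A : set V) : set V :=
  [set x | A x /\
     forall (y z : V) (t : R), A y -> A z -> 0 < t < 1 ->
       x = t *: y + (1 - t) *: z -> y = x /\ z = x].

Definition sylvester_simplex (R : realType) : set (space15 R) :=
  conv (sylvester_row R).

Definition cube (R : realType) (n : nat) : set (space15 R) :=
  [set x | forall j : index15, - n%:R <= (x j : R) <= n%:R].

Definition Pmn (R : realType) (m n : nat) : set (space15 R) :=
  dilate m%:R (sylvester_simplex R) `&` cube R n.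

(* (n + 2Z)^15 *)
Definition Lambda (R : realType) (n : nat) : set (space15 R) :=
  [set x | forall j : index15, exists z : int, (x j : R) = n%:R + 2 * z%:~R].

Definition integral_in {R : realType} {V : lmodType R} (A L : set V) : Prop :=
  vertices A `<=` L.

Definition is_normal (R : realType) (m n : nat) : Prop :=
  forall k : nat, (0 < k)%N ->
  forall x : space15 R, dilate k%:R (Pmn R m n) x -> Lambda R (k * n) x ->
  exists p : 'I_k -> space15 R,
    (forall i, (Pmn R m n `&` Lambda R n) (p i)) /\ x = \sum_i p i.

(* Main.v *)
Require Import Defs.
From mathcomp Require Import all_boot all_order all_algebra.
From mathcomp Require Import classical_sets reals.
From mathcomp Require Import zify ring lra.

(** Extend x in R^15 by x_0 = 1 to a function X on F_2^4 and let HX be its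
    Walsh transform.  The matrix of H is 4 times an orthogonal one, so the
    barycentric coordinates of x in 5 Delta are ((HX)_r + 4) / 80, and
    P_{5,1} is cut out by |x_j| <= 1 and (HX)_r >= -4 ([Pmn51P]).

    Integrality.  Let x be a vertex, F the set of j with |x_j| < 1, f = |F|.
    Since x cannot be moved inside F, the tight rows (HX)_r = -4 restricted to
    F have full column rank, so f of them form an invertible sign matrix M
    ([vertex_tight_rows]).  Two estimates of different nature then collide.
    - Parseval and Cauchy-Schwarz: f tight rows and sum_r (HX)_r = 16 force
      sum_j X_j^2 to be large, while each j in F makes it smaller than 16
      ([walsh_tight_bound]).  This leaves f <= 5.
    - Arithmetic: z = (1 - x)/2 solves M z = c on F, with c integral and all
      c_r congruent modulo 2.  By Cramer's rule z has denominator dividing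
      k = |det M| / 2^(f-1) ([cramer_congruent]), and k <= 1, 1, 1, 2, 4 for
      f = 1, ..., 5 ([det_sign_mx_le]).  As 0 < z_j < 1, this excludes f <= 3;
      for f = 5 it puts z_j in [1/4, 3/4], which the first estimate forbids.
    For f = 4 it gives x = 0 on F, and then all rows of M have the same parity
    of minus signs, so that M M^T = 4 I.  Replacing the four zeros by
    -M^T 1 / 2 gives a vector of squared norm 16 whose transform is -6 on four
    rows; this contradicts the first estimate again ([no_four_free_coords]).

    Failure of normality.  A point y of P_{5,1} with coordinates in {-1, 0, 1}
    has 2y in the lattice for k = 2, and a decomposition of 2y is
    (y + e) + (y - e) with e a choice of signs on the zeros of y.  The chosen y
    vanishes exactly on the three nonzero elements of a plane W, and
    (Hy)_r = -3 for representatives r of all four characters of W.  Hence each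
    of these characters has a sum against e of absolute value at most 1; but
    the sign patterns of the four characters on W \ 0 are, up to a global sign,
    all the sign patterns on three points, so one of the sums is +3 or -3
    ([not_normal_Pmn51]). *)

Set Implicit Arguments.
Unset Strict Implicit.
Unset Printing Implicit Defensive.
Import Order.TTheory GRing.Theory Num.Theory.
Local Open Scope ring_scope.

(** * Determinants of sign matrices *)

Definition sign_mx m n (M : 'M[int]_(m, n)) := forall i j, `|M i j| = 1.

(** Expand along the first row.  The second row is orthogonal to the cofactors
    of the first, so it may be added to or subtracted from it; one of the two
    choices leaves at most half of the entries nonzero, each equal to 2 in
    absolute value.  This is weaker than Hadamard's bound in general, but
    sharp enough up to size 5. *)
Lemma det_sign_mx_step n (B : int) :
    (forall N : 'M[int]_n.+1, sign_mx N -> `|\det N| <= B) ->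
  forall M : 'M[int]_n.+2, sign_mx M -> `|\det M| <= (n.+2)./2.*2%:R * B.
Proof.
move=> leB M sM.
have leC j : `|cofactor M 0 j| <= B.
  rewrite /cofactor normrM normrX normrN1 expr1n mul1r.
  by apply: leB => i k; rewrite !mxE.
have B_ge0 : 0 <= B by apply: le_trans (leC 0).
pose s (b : bool) : int := (-1) ^+ b.
have detE b : \det M = \sum_j (M 0 j + s b * M 1 j) * cofactor M 0 j.
  rewrite (expand_det_row _ 0) -[LHS]addr0.
  under [RHS]eq_bigr => j _ do rewrite mulrDl -mulrA.
  rewrite big_split /= -mulr_sumr; congr (_ + _).
  have /matrixP/(_ 1 0) := mul_mx_adj M; rewrite !mxE /= mulr0n => E.
  rewrite -[X in _ * X](_ : 0 = _) ?mulr0 // -[LHS]E.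
  by apply: eq_bigr => j _; rewrite [(\adj M) _ _]mxE.
pose S b := [set j | M 0 j == s b * M 1 j].
have bound b : `|\det M| <= #|S b|%:R * 2 * B.
  rewrite (detE b) (le_trans (ler_norm_sum _ _ _)) //.
  rewrite (bigID (mem (S b))) /= [X in _ + X]big1 ?addr0.
    rewrite -mulrA mulr_natl -sumr_const; apply: ler_sum => j.
    rewrite inE => /eqP ->; rewrite normrM; apply: ler_pM => //.
    by rewrite -mulr2n normrMn normrM sM /s normrX normrN1 expr1n.
  move=> j; rewrite inE => neq.
  rewrite (_ : _ + _ = 0) ?mul0r ?normr0 //.
  have /eqP := sM 0 j; have /eqP := sM 1 j; move: neq.
  rewrite !eqr_norml /s !ler01 !andbT.
  by move=> + /orP[]/eqP E1 /orP[]/eqP E0; rewrite E0 E1; case: b.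
have cardS : (#|S false| + #|S true| <= n.+2)%N.
  rewrite -[leqRHS](card_ord n.+2) -(cardsC (S false)) leq_add2l.
  rewrite subset_leq_card //; apply/fintype.subsetP => j; rewrite !inE /s.
  move=> /eqP->; rewrite expr1 expr0 mul1r mulN1r.
  by have := sM 1 j; lia.
have [b leS] : exists b, (#|S b| <= n.+2./2)%N.
  have [le0|lt0] := leqP #|S false| n.+2./2; first by exists false.
  by exists true; lia.
rewrite (le_trans (bound b)) // ler_wpM2r // -muln2 natrM ler_wpM2r //.
by rewrite ler_nat.
Qed.

(** Subtracting the first row from the others makes these even. *)
Lemma det_congruent_rows n (A : 'M[int]_n.+1) :
  (forall i j, (2 %| A i j - A ord0 j)%Z) -> (2 ^+ n %| \det A)%Z.
Proof.
move=> dvdA.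
pose L : 'M[int]_n.+1 := \matrix_(i, l)
  (if i == 0 then (l == 0)%:R else if l == 0 then 1 else 2 * (i == l)%:R).
pose B : 'M[int]_n.+1 := \matrix_(i, j)
  if i == 0 then A 0 j else ((A i j - A ord0 j) %/ 2)%Z.
have -> : A = L *m B.
  apply/matrixP => i j; rewrite !mxE big_ord_recl !mxE /=.
  case: (unliftP 0 i) => [i'|] -> /=; last first.
    by rewrite mul1r big1 ?addr0 // => l _; rewrite !mxE /= mul0r.
  rewrite (bigD1 i') //= !mxE /= eqxx mulr1 big1 ?addr0.
    by rewrite mul1r mulrC divzK // addrC subrK.
  move=> l ne; rewrite !mxE /= (inj_eq lift_inj) eq_sym (negbTE ne).
  by rewrite mulr0 mul0r.
have trigL : is_trig_mx L.
  apply/is_trig_mxP => i l lt_il; rewrite !mxE.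
  have -> : (l == 0) = false by apply/eqP => l0; rewrite l0 in lt_il.
  by rewrite -[i == l]val_eqE (ltn_eqF lt_il) mulr0 if_same.
rewrite det_mulmx det_trig // big_ord_recl !mxE /= mul1r.
rewrite (eq_bigr (fun=> 2)) => [|i _]; last by rewrite !mxE /= eqxx mulr1.
by rewrite prodr_const card_ord dvdz_mulr.
Qed.

(** Bounds on |det M| / 2^n for sign matrices M of size n + 1 <= 5. *)
Definition max_denominator (n : nat) : int := nth 0 [:: 1; 1; 1; 2; 4] n.

Lemma det_sign_mx_le n (M : 'M[int]_n.+1) : (n < 5)%N -> sign_mx M ->
  `|\det M| <= 2 ^+ n * max_denominator n.
Proof.
have D1 (N : 'M[int]_1) : sign_mx N -> `|\det N| <= 1.
  by move=> sN; rewrite det_mx11 sN.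
have D2 := det_sign_mx_step D1; have D3 := det_sign_mx_step D2.
have D4 := det_sign_mx_step D3; have D5 := det_sign_mx_step D4.
by case: n M => [|[|[|[|[|]]]]] // M _ sM;
  [exact: D1 | exact: D2 | exact: D3 | exact: D4 | exact: D5].
Qed.

Lemma sign_mx_odd_sub (a b : int) : `|a| = 1 -> `|b| = 1 -> (2 %| a - b)%Z.
Proof. by move=> ? ?; lia. Qed.

(** Cramer's rule: the determinant obtained by putting c in a column of M still
    has pairwise congruent rows modulo 2. *)
Lemma cramer_congruent (F : numFieldType) n (M : 'M[int]_n.+1)
    (c : 'cV[int]_n.+1) (z : 'cV[F]_n.+1) :
    sign_mx M -> (forall i, (2 %| c i ord0 - c ord0 ord0)%Z) ->
    map_mx intr M *m z = map_mx intr c ->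
  forall j, exists q : int, (\det M)%:~R * z j ord0 = (2 ^+ n * q)%:~R.
Proof.
move=> sM dvdc Mz j.
pose N : 'M[int]_n.+1 := \matrix_(i, k) if k == j then c i ord0 else M i k.
have /dvdzP[q detN] : (2 ^+ n %| \det N)%Z.
  apply: det_congruent_rows => i k; rewrite !mxE.
  by case: ifP => _; [exact: dvdc | exact: sign_mx_odd_sub].
exists q; rewrite [_ * q]mulrC -detN.
have -> : \det N = (\adj M *m c) j ord0.
  rewrite (expand_det_col _ j) mxE; apply: eq_bigr => i _.
  rewrite !mxE eqxx mulrC /cofactor; congr (_ * \det _ * _).
  by apply/matrixP => k l; rewrite !mxE eq_sym (negbTE (neq_lift _ _)).
have /(congr1 (mulmx (map_mx intr (\adj M)))) := Mz.
rewrite mulmxA -!map_mxM mul_adj_mx /= map_scalar_mx mul_scalar_mx.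
by move=> /matrixP/(_ j ord0); rewrite !mxE => ->.
Qed.

Lemma sign_system_denominator (F : numFieldType) n (M : 'M[int]_n.+1)
    (c : 'cV[int]_n.+1) (z : 'cV[F]_n.+1) :
    (n < 5)%N -> sign_mx M -> (forall i, (2 %| c i ord0 - c ord0 ord0)%Z) ->
    map_mx intr M *m z = map_mx intr c -> \det M != 0 ->
  forall j, exists k q : int,
    0 < k <= max_denominator n /\ k%:~R * z j ord0 = q%:~R.
Proof.
move=> lt_n5 sM dvdc Mz det0 j.
have [q Eq] := cramer_congruent sM dvdc Mz j.
have p2 : 0 < 2 ^+ n :> int by rewrite exprn_gt0.
have /dvdzP[d detM] : (2 ^+ n %| \det M)%Z.
  by apply: det_congruent_rows => i l; apply: sign_mx_odd_sub.
have := det_sign_mx_le lt_n5 sM.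
rewrite detM normrM (gtr0_norm p2) mulrC ler_pM2l // => le_d.
have d0 : d != 0 by apply: contraNneq det0 => d0; rewrite detM d0 mul0r.
have Ed : d%:~R * z j ord0 = q%:~R.
  apply: (@mulfI _ (2 ^+ n)%:~R); first by rewrite intr_eq0 gt_eqF.
  by rewrite mulrA -!rmorphM /= [_ * d]mulrC -detM.
exists `|d|, (Num.sg d * q); rewrite normr_gt0 d0 le_d; split=> //.
by rewrite intrM -Ed mulrA -intrM normrEsg.
Qed.

(** The number of disagreements between a and b is even, because it has the
    parity of half the difference of the sums; of 0, 2 and 4 disagreements, the
    case of 2 is orthogonality. *)
Lemma even_sign_rows (a b : 'I_4 -> int) :
    (forall j, `|a j| = 1) -> (forall j, `|b j| = 1) ->
    (4 %| (\sum_j a j) - \sum_j b j)%Z ->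
  [\/ \sum_j a j * b j = 0, forall j, a j = b j | forall j, a j = - b j].
Proof.
move=> sa sb dvd4; set E := \sum_j a j * b j.
have ab j : [\/ a j * b j = 1 /\ a j = b j | a j * b j = -1 /\ a j = - b j].
  by have := sa j; have := sb j; nia.
have sumB s : \sum_(j < 4) (1 - s * (a j * b j)) = 4 - s * E.
  by rewrite sumrB sumr_const card_ord -mulr_sumr.
have dvdE : (4 %| 4 - 1 * E)%Z.
  have -> : 4 - 1 * E = (\sum_j a j) - (\sum_j b j)
      + \sum_j (1 - 1 * (a j * b j) - (a j - b j)).
    by rewrite -sumB -sumrB -big_split /=; apply: eq_bigr => j _; ring.
  rewrite rpredD // rpred_sum // => j _; rewrite -[_ \in _]/(4 %| _)%Z.
  by have := sa j; have := sb j; case: (ab j) => -[-> ->]; lia.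
have bound s : `|s| = 1 -> 0 <= 4 - s * E.
  by move=> s1; rewrite -sumB sumr_ge0 // => j _; case: (ab j) => -[-> _]; lia.
have all_ab s : `|s| = 1 -> 4 - s * E = 0 -> forall j, s * (a j * b j) = 1.
  move=> s1; rewrite -sumB => /psumr_eq0P E0 j; apply/eqP.
  rewrite eq_sym -subr_eq0 E0 // => k _.
  by case: (ab k) => -[-> _]; lia.
have := bound 1 erefl; have := bound (-1) erefl => le1 le2.
have [E0|[E4|E4]] : E = 0 \/ 4 - 1 * E = 0 \/ 4 - (-1) * E = 0 by lia.
- exact: Or31.
- by apply: Or32 => j; have := all_ab 1 erefl E4 j; case: (ab j) => -[-> ->].
by apply: Or33 => j; have := all_ab (-1) erefl E4 j; case: (ab j) => -[-> ->].
Qed.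

Lemma sign_rows_orthogonal (M : 'M[int]_4) : sign_mx M ->
    (forall i, (4 %| (\sum_j M i j) - \sum_j M ord0 j)%Z) -> \det M != 0 ->
  M *m M^T = 4%:M.
Proof.
move=> sM dvd4 det0; apply/matrixP => i k; rewrite !mxE.
under eq_bigr => j _ do rewrite mxE.
have [<-|ne_ik] := eqVneq i k.
  rewrite (eq_bigr (fun=> 1)) ?sumr_const ?card_ord ?mulr1n // => j _.
  by rewrite -expr2 -real_normK ?num_real // sM expr1n.
have dvd_ik : (4 %| (\sum_j M i j) - \sum_j M k j)%Z.
  by have := dvd4 i; have := dvd4 k; lia.
rewrite mulr0n; case: (even_sign_rows (sM i) (sM k) dvd_ik) => //.
- move=> eq_ik; case/negP: det0; apply/eqP.
  exact: determinant_alternate ne_ik eq_ik.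
move=> opp_ik; case/negP: det0; apply/eqP.
pose v : 'rV[int]_4 := delta_mx 0 i + delta_mx 0 k.
have : v *m M *m \adj M = 0.
  rewrite mulmxDl -!rowE (_ : _ + _ = 0) ?mul0mx //.
  by apply/rowP => j; rewrite !mxE opp_ik addNr.
rewrite -mulmxA mul_mx_adj mul_mx_scalar => /rowP/(_ i).
by rewrite !mxE !eqxx (negbTE ne_ik) addr0 mulr1.
Qed.

(** * The Walsh transform on F_2^4 *)

Local Notation V := 'rV['F_2]_4.

Lemma dotF2C r j : dotF2 r j = dotF2 j r.
Proof. by apply: eq_bigr => i _; rewrite mulrC. Qed.

Lemma dotF2Dl r s j : dotF2 (r + s) j = dotF2 r j + dotF2 s j.
Proof.
by rewrite /dotF2 -big_split /=; apply: eq_bigr => i _; rewrite mxE mulrDl.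
Qed.

Lemma dotF2_delta i j : dotF2 (delta_mx 0 i) j = j 0 i.
Proof.
rewrite /dotF2 (bigD1 i) //= mxE !eqxx mul1r big1 ?addr0 // => k ne.
by rewrite mxE (negbTE ne) andbF mul0r.
Qed.

Lemma signF2D (A : pzRingType) (a b : 'F_2) :
  (-1) ^+ nat_of_ord (a + b) = (-1) ^+ nat_of_ord a * (-1) ^+ nat_of_ord b :> A.
Proof. by rewrite -exprD -signr_odd -[RHS]signr_odd /= modn2 oddb. Qed.

(** Integer-valued copy of the Sylvester signs, for divisibility arguments. *)
Definition int_sylvester (r j : V) : int := (-1) ^+ nat_of_ord (dotF2 r j).

Lemma normr_int_sylvester r j : `|int_sylvester r j| = 1.
Proof. by rewrite /int_sylvester normrX normrN1 expr1n. Qed.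

Section Walsh.
Variable R : realType.
Implicit Types (X : V -> R) (r s j k : V).

Lemma sylvesterE r j : sylvester R r j = (int_sylvester r j)%:~R.
Proof. by rewrite /sylvester /int_sylvester rmorphXn rmorphN1. Qed.

Lemma sylvesterC r j : sylvester R r j = sylvester R j r.
Proof. by rewrite /sylvester dotF2C. Qed.

Lemma sylvesterDl r s j :
  sylvester R (r + s) j = sylvester R r j * sylvester R s j.
Proof. by rewrite /sylvester dotF2Dl signF2D. Qed.

Lemma sylvesterDr r j k :
  sylvester R r (j + k) = sylvester R r j * sylvester R r k.
Proof. by rewrite !(sylvesterC r) sylvesterDl. Qed.

Lemma sylvester0r r : sylvester R r 0 = 1.
Proof. by rewrite /sylvester /dotF2 big1 // => i _; rewrite mxE mulr0. Qed.

Lemma sylvester_sqr r j : sylvester R r j * sylvester R r j = 1.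
Proof. by rewrite /sylvester -expr2 sqrr_sign. Qed.

Lemma addF2_eq0 j k : (j + k == 0) = (j == k).
Proof.
rewrite addr_eq0; congr (_ == _); apply/rowP => i; rewrite mxE.
by case: (k 0 i) => [[|[|]]] // lt; apply/val_inj.
Qed.

Lemma sum_sylvester j : \sum_r sylvester R r j = 16 * (j == 0)%:R.
Proof.
have [->|j0] := eqVneq j 0.
  under eq_bigr => r _ do rewrite sylvester0r.
  by rewrite sumr_const card_mx card_Fp // mulr1.
have [i ji] : exists i, j 0 i != 0.
  apply/existsP; apply: contraNT j0; rewrite negb_exists => /forallP j0.
  by apply/eqP/rowP => i; rewrite mxE; apply/eqP; have := j0 i; rewrite negbK.
(* Translation by a basis vector not orthogonal to j changes all signs. *)
have : \sum_r sylvester R r j = - \sum_r sylvester R r j.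
  rewrite {1}(reindex_inj (addrI (delta_mx 0 i))) -sumrN.
  apply: eq_bigr => r _; rewrite sylvesterDl {1}/sylvester dotF2_delta.
  have -> : j 0 i = 1.
    by case: (j 0 i) ji => [[|[|]]] // lt _; apply/val_inj.
  by rewrite mulN1r.
by rewrite mulr0; lra.
Qed.

Lemma sylvester_orthogonal j k :
  \sum_r sylvester R r j * sylvester R r k = 16 * (j == k)%:R.
Proof.
under eq_bigr => r _ do rewrite -sylvesterDr.
by rewrite sum_sylvester addF2_eq0.
Qed.

Definition walsh X r : R := \sum_j sylvester R r j * X j.

Lemma walsh_inversion X j : \sum_r sylvester R r j * walsh X r = 16 * X j.
Proof.
under eq_bigr => r _ do rewrite mulr_sumr.
rewrite exchange_big (bigD1 j) //= [X in _ + X]big1 ?addr0 => [|k ne].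
  under eq_bigr => r _ do rewrite mulrA sylvester_sqr mul1r.
  by rewrite sumr_const card_mx card_Fp // mulr_natl.
under eq_bigr => r _ do rewrite mulrA.
by rewrite -mulr_suml sylvester_orthogonal eq_sym (negbTE ne) mulr0 mul0r.
Qed.

Lemma sum_walsh X : \sum_r walsh X r = 16 * X 0.
Proof.
rewrite -walsh_inversion.
by under [RHS]eq_bigr => r _ do rewrite sylvester0r mul1r.
Qed.

Lemma walsh_parseval X : \sum_r walsh X r ^+ 2 = 16 * \sum_j X j ^+ 2.
Proof.
under eq_bigr => r _ do rewrite expr2 {1}/walsh mulr_suml.
rewrite exchange_big mulr_sumr; apply: eq_bigr => j _ /=.
rewrite expr2 mulrA -walsh_inversion mulr_suml; apply: eq_bigr => r _.
by rewrite mulrAC.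
Qed.

(** Cauchy-Schwarz, as the nonnegativity of the variance of a on P. *)
Lemma sum_sqr_ge (I : finType) (P : pred I) (a : I -> R) :
  (\sum_(i | P i) a i) ^+ 2 <= #|P|%:R * \sum_(i | P i) a i ^+ 2.
Proof.
have [n0|n_gt0] := posnP #|P|.
  by rewrite n0 mul0r big_pred0 ?expr0n ?lexx // => i; exact: (card0_eq n0).
have nR : 0 < #|P|%:R :> R by rewrite ltr0n.
set n := #|P|%:R in nR *; set s := \sum_(i | P i) a i.
have : 0 <= \sum_(i | P i) (n * a i - s) ^+ 2.
  by rewrite sumr_ge0 // => *; rewrite sqr_ge0.
have sqrE i : (n * a i - s) ^+ 2
    = n ^+ 2 * a i ^+ 2 - (2 * n * s) * a i + s ^+ 2 by ring.
rewrite (eq_bigr _ (fun i _ => sqrE i)).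
rewrite big_split sumrB -!mulr_sumr sumr_const /= -/s -mulr_natl -/n.
rewrite (_ : _ + _ = n * (n * \sum_(i | P i) a i ^+ 2 - s ^+ 2)); last by ring.
by rewrite pmulr_rge0 // subr_ge0.
Qed.

(** Off T the transform still has to sum to 16 + #|T| h, and Parseval leaves it
    only the square mass 16 sum_j X_j^2 - #|T| h^2: Cauchy-Schwarz compares
    the two. *)
Lemma walsh_tight_bound X (T : {set V}) (h : R) :
    X 0 = 1 -> (forall r, r \in T -> walsh X r = - h) ->
  (16 + #|T|%:R * h) ^+ 2
    <= (16 - #|T|%:R) * (16 * (\sum_j X j ^+ 2) - #|T|%:R * h ^+ 2).
Proof.
move=> X0 XT.
have splitT (f : R -> R) : \sum_r f (walsh X r)
    = #|T|%:R * f (- h) + \sum_(r | r \notin T) f (walsh X r).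
  rewrite (bigID (mem T)) /=; congr (_ + _).
  by rewrite (eq_bigr (fun=> f (- h))) ?sumr_const ?mulr_natl // => r /XT ->.
have := splitT id; rewrite sum_walsh X0 /= => E1.
have := splitT (fun a => a ^+ 2); rewrite walsh_parseval /= => E2.
have -> : 16 + #|T|%:R * h = \sum_(r | r \notin T) walsh X r by lra.
have -> : 16 * (\sum_j X j ^+ 2) - #|T|%:R * h ^+ 2
    = \sum_(r | r \notin T) walsh X r ^+ 2 by rewrite E2 sqrrN; ring.
have -> : 16 - #|T|%:R = #|[predC T]|%:R :> R.
  have := cardC (mem T); rewrite card_mx card_Fp //.
  move=> /(congr1 (fun n => n%:R : R)); rewrite natrD => E.
  by rewrite -E; lra.
exact: sum_sqr_ge.
Qed.

(** The column j = 0, deleted from the Sylvester matrix, comes back with the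
    coordinate 1; this makes the transform orthogonal up to a factor. *)
Definition ext (x : space15 R) (j : V) : R :=
  oapp (x : index15 -> R) 1 (insub j).

Lemma ext_val (x : space15 R) (k : index15) : ext x (val k) = x k.
Proof. by rewrite /ext valK. Qed.

Lemma ext0 (x : space15 R) : ext x 0 = 1.
Proof. by rewrite /ext insubF ?eqxx. Qed.

(** The simplex in terms of its facets: the weights of a point of 5 Delta are
    recovered by Walsh inversion as ((HX)_r + 4) / 80. *)
Lemma Pmn51P (x : space15 R) :
  Pmn R 5 1 x <->
  (forall j, `|ext x j| <= 1) /\ (forall r, -4 <= walsh (ext x) r).
Proof.
split.
  move=> [] [_ [a [a0 a1 ->] <-]] cub.
  set x0 := _ *: _ in cub *.
  have extE j : ext x0 j = 5 * (\sum_r a r * sylvester R r j) - 4 * (j == 0)%:R.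
    have [->|j0] := eqVneq j 0.
      rewrite ext0; under eq_bigr => r _ do rewrite sylvester0r mulr1.
      by rewrite a1 !mulr1; lra.
    have -> : j = val (Sub j j0 : index15) by [].
    rewrite ext_val mulr0 subr0 /x0 !ffunE sum_ffunE; congr (_ * _).
    by apply: eq_bigr => r _; rewrite !ffunE.
  split=> [j|r].
    have [->|j0] := eqVneq j 0; first by rewrite ext0 normr1.
    have -> : j = val (Sub j j0 : index15) by [].
    by rewrite ext_val ler_norml; apply: cub.
  have -> : walsh (ext x0) r = 80 * a r - 4.
    rewrite /walsh; under eq_bigr => j _ do rewrite extE mulrBr.
    rewrite sumrB [X in _ - X](bigD1 0) //= eqxx sylvester0r.
    rewrite [X in _ - (_ + X)]big1 ?addr0.
      congr (_ - _); last by rewrite mul1r mulr1.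
      under eq_bigr => j _ do rewrite mulrCA.
      rewrite -mulr_sumr; under eq_bigr => j _ do rewrite mulr_sumr.
      rewrite exchange_big (bigD1 r) //= [X in _ + X]big1 ?addr0.
        under eq_bigr => j _ do rewrite mulrCA sylvester_sqr mulr1.
        by rewrite sumr_const card_mx card_Fp // -mulr_natl; ring.
      move=> s ne; under eq_bigr => j _ do rewrite mulrCA !(sylvesterC _ j).
      by rewrite -mulr_sumr sylvester_orthogonal eq_sym (negbTE ne) !mulr0.
    by move=> j ne; rewrite (negbTE ne) !mulr0.
  by have := a0 r; lra.
move=> [x1 w4]; split.
  pose a r := (walsh (ext x) r + 4) / 80.
  have aE j : \sum_r a r * sylvester R r j = (ext x j + 4 * (j == 0)%:R) / 5.
    rewrite (eq_bigr (fun r => (sylvester R r j * walsh (ext x) r) / 80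
                               + sylvester R r j / 20)).
      by rewrite big_split -!mulr_suml walsh_inversion sum_sylvester /=; field.
    by move=> r _; rewrite /a; field.
  exists (5^-1 *: x); last by rewrite scalerA divff ?scale1r // pnatr_eq0.
  exists a; split.
  - by move=> r; rewrite /a divr_ge0 //; have := w4 r; lra.
  - have := aE 0; rewrite ext0 eqxx.
    under eq_bigr => r _ do rewrite sylvester0r mulr1.
    by move=> ->; rewrite mulr1; field.
  apply/ffunP => j; rewrite !ffunE sum_ffunE.
  transitivity ((ext x (val j) + 4 * (val j == 0)%:R) / 5).
    by rewrite (negbTE (valP j)) mulr0 addr0 ext_val mulrC.
  by rewrite -aE; apply: eq_bigr => r _; rewrite !ffunE.
by move=> j; have := x1 (val j); rewrite ext_val ler_norml.
Qed.

End Walsh.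

(** * Tight inequalities at a vertex *)

Section Vertex.
Variable R : realType.

(** A direction that vanishes on all tight constraints can be followed for a
    positive time. *)
Lemma slack_step (I : finType) (s d : I -> R) :
    (forall i, 0 <= s i) -> (forall i, s i = 0 -> d i = 0) ->
  exists2 e, 0 < e & forall i, e * `|d i| <= s i.
Proof.
move=> s0 sd; pose q := \sum_i `|d i| / s i.
have q0 : 0 <= q by apply: sumr_ge0 => i _; rewrite divr_ge0.
have q1 : 0 < 1 + q by lra.
exists (1 + q)^-1; rewrite ?invr_gt0 // => i.
have [si|si] := eqVneq (s i) 0; first by rewrite (sd _ si) si normr0 mulr0.
have si0 : 0 < s i by rewrite lt_def si s0.
rewrite mulrC ler_pdivrMr // -ler_pdivrMl // mulrC.
rewrite (@le_trans _ _ q) ?lerDr // /q (bigD1 i) //= lerDl.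
by apply: sumr_ge0 => k _; rewrite divr_ge0.
Qed.

Definition free_coords (x : space15 R) : {set V} := [set j | `|ext x j| < 1].

Lemma free_coords0 x : 0 \notin free_coords x.
Proof. by rewrite inE ext0 normr1 ltxx. Qed.

(** Otherwise some nonzero vector supported on the free coordinates is killed by
    all tight rows, and the vertex is the midpoint of a segment of the polytope
    in that direction. *)
Lemma vertex_tight_rows (x : space15 R) : vertices (Pmn R 5 1) x ->
  exists rho : 'I_#|free_coords x| -> V,
    [/\ injective rho, forall i, walsh (ext x) (rho i) = -4
      & \det (\matrix_(i, k) int_sylvester (rho i) (enum_val k)) != 0].
Proof.
case=> xP xV; have [x1 x4] := (Pmn51P x).1 xP.
set F := free_coords x; pose T := [set r | walsh (ext x) r == -4].
pose A : 'M[R]_(#|T|, #|F|) :=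
  \matrix_(i, k) sylvester R (enum_val i) (enum_val k).
have [fullA|] := boolP (row_full A).
  pose g := fullrankfun fullA; exists (fun i => enum_val (g i)); split.
  - by move=> i i' /enum_val_inj /(@fullrankfun_inj _ _ _ _ fullA).
  - by move=> i; have := enum_valP (g i); rewrite inE => /eqP.
  have : rowsub g A \in unitmx.
    by rewrite -row_full_unit; apply: fullrowsub_full.
  rewrite unitmxE unitfE; apply: contraNneq => det0.
  rewrite (_ : rowsub g A =
    map_mx intr (\matrix_(i, k) int_sylvester (enum_val (g i)) (enum_val k))).
    by rewrite det_map_mx det0.
  by apply/matrixP => i k; rewrite !mxE sylvesterE.
rewrite /row_full -mxrank_tr -/(row_free A^T) -kermx_eq0 => /rowV0Pn[u].
move=> /sub_kermxP uA u0.
pose U j := \sum_k u ord0 k * (j == enum_val k)%:R.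
have U_val k : U (enum_val k) = u ord0 k.
  rewrite /U (bigD1 k) //= eqxx mulr1 big1 ?addr0 // => l ne.
  by rewrite (inj_eq enum_val_inj) eq_sym (negbTE ne) mulr0.
have U_out j : j \notin F -> U j = 0.
  move=> jF; rewrite /U big1 // => k _.
  rewrite (_ : (j == _) = false) ?mulr0 //.
  by apply: contraNF jF => /eqP->; exact: enum_valP.
have wU r : r \in T -> walsh U r = 0.
  move=> rT; have := congr1 (fun B : 'rV_#|T| => B ord0 (enum_rank_in rT r)) uA.
  rewrite !mxE => <-; rewrite /walsh /U.
  under eq_bigr => j _ do rewrite mulr_sumr.
  rewrite exchange_big; apply: eq_bigr => k _.
  rewrite !mxE enum_rankK_in // (bigD1 (enum_val k)) //= eqxx mulr1 mulrC.
  by rewrite big1 ?addr0 // => j ne; rewrite (negbTE ne) !mulr0.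
pose xU : space15 R := [ffun k => U (val k)].
have extE e j : ext (x + e *: xU) j = ext x j + e * U j.
  have [->|j0] := eqVneq j 0.
    by rewrite !ext0 (U_out 0) ?free_coords0 // mulr0 addr0.
  have -> : j = val (Sub j j0 : index15) by [].
  by rewrite !ext_val !ffunE.
have walshE e r : walsh (ext (x + e *: xU)) r = walsh (ext x) r + e * walsh U r.
  rewrite /walsh mulr_sumr -big_split; apply: eq_bigr => j _ /=.
  by rewrite extE mulrDr mulrCA.
pose s (i : V + V) :=
  match i with inl j => 1 - `|ext x j| | inr r => walsh (ext x) r + 4 end.
pose d (i : V + V) := match i with inl j => U j | inr r => walsh U r end.
have [||e e0 es] := @slack_step _ s d.
- by case=> [j|r] /=; [have := x1 j | have := x4 r]; lra.
- case=> [j|r] /= s0.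
    by apply: U_out; rewrite inE -leNgt; lra.
  by apply: wU; rewrite inE; apply/eqP; lra.
have inP t : `|t| <= e -> Pmn R 5 1 (x + t *: xU).
  move=> te; apply/Pmn51P; split=> [j|r].
    rewrite extE (le_trans (ler_normD _ _)) // normrM.
    have := es (inl j); have : `|t| * `|U j| <= e * `|U j| by rewrite ler_wpM2r.
    by rewrite /=; lra.
  rewrite walshE; have := es (inr r) => /=.
  have : `|t * walsh U r| <= e * `|walsh U r| by rewrite normrM ler_wpM2r.
  by rewrite ler_norml => /andP[]; lra.
have [] := xV (x + e *: xU) (x + (- e) *: xU) (2^-1).
- by apply: inP; rewrite gtr0_norm.
- by apply: inP; rewrite normrN gtr0_norm.
- by apply/andP; split; lra.
- apply/ffunP => k; rewrite !ffunE; rewrite /GRing.scale /=.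
  by field.
move=> /ffunP xe _; case/eqP: u0; apply/rowP => k; rewrite mxE -U_val.
have k0 : (enum_val k : V) != 0.
  by apply: contraNneq (free_coords0 x) => <-; exact: enum_valP.
have := xe (Sub (enum_val k) k0); rewrite !ffunE {1}/GRing.scale /= => xek.
have /eqP : e * U (enum_val k) = 0 by lra.
by rewrite mulf_eq0 gt_eqF //= => /eqP.
Qed.

End Vertex.

(** * Rounding out the fractional coordinates *)

(** The situation at a vertex with n + 1 >= 1 free coordinates [gamma k] and as
    many tight rows [rho i], whose sign matrix M is invertible. *)
Section Tight.
Variables (R : realType) (n : nat) (X : V -> R) (rho gamma : 'I_n.+1 -> V).
Hypothesis X0 : X 0 = 1.
Hypotheses (rho_inj : injective rho) (gamma_inj : injective gamma).
Hypothesis X_free : forall k, `|X (gamma k)| < 1.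
Hypothesis X_fixed : forall j, j \notin codom gamma -> `|X j| = 1.
Hypothesis X_tight : forall i, walsh X (rho i) = -4.
Let M : 'M[int]_n.+1 := \matrix_(i, k) int_sylvester (rho i) (gamma k).
Hypothesis detM : \det M != 0.

Lemma sign_mx_tight : sign_mx M.
Proof. by move=> i k; rewrite mxE normr_int_sylvester. Qed.

Lemma sum_split_free (A : nmodType) (G : V -> A) :
  \sum_j G j = \sum_k G (gamma k) + \sum_(j | j \notin codom gamma) G j.
Proof.
rewrite (bigID (mem (codom gamma))) /=; congr (_ + _).
rewrite -(big_uniq _ (_ : uniq (codom gamma))) ?big_image //.
exact/injectiveP.
Qed.

(** The defect of X from having squared norm 16. *)
Let S := \sum_k (1 - X (gamma k) ^+ 2).

Lemma sum_sqr_tight : \sum_j X j ^+ 2 = 16 - S.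
Proof.
have : \sum_(j : V) (1 : R) = 16 by rewrite sumr_const card_mx card_Fp.
rewrite /S !sum_split_free sumrB.
have -> : \sum_(j | j \notin codom gamma) X j ^+ 2 =
   \sum_(j | j \notin codom gamma) 1.
  apply: eq_bigr => j /X_fixed X1.
  by rewrite -real_normK ?num_real // X1 expr1n.
by lra.
Qed.

Lemma tight_bound (Y : V -> R) h : Y 0 = 1 ->
    (forall i, walsh Y (rho i) = - h) ->
  (16 + n.+1%:R * h) ^+ 2
    <= (16 - n.+1%:R) * (16 * (\sum_j Y j ^+ 2) - n.+1%:R * h ^+ 2).
Proof.
move=> Y0 Yh; have := @walsh_tight_bound R Y [set rho i | i : 'I_n.+1] h Y0.
rewrite card_imset // card_ord; apply=> r /imsetP[i _ ->]; exact: Yh.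
Qed.

Lemma S_term_gt0 k : 0 < 1 - X (gamma k) ^+ 2.
Proof.
rewrite subr_gt0 -real_normK ?num_real //.
by rewrite exprn_ilt1.
Qed.

Lemma tight_bound_S :
  (4 + n.+1%:R) ^+ 2 <= (16 - n.+1%:R) * (16 - S - n.+1%:R).
Proof.
by have := tight_bound X0 X_tight; rewrite sum_sqr_tight; lra.
Qed.

(** With f free coordinates the estimate reads
    (4 + f)^2 <= (16 - f) (16 - f - S) with S > 0, hence 4 + f < 16 - f. *)
Lemma few_free_coords : (n < 5)%N.
Proof.
have S0 : 0 < S.
  rewrite /S big_ord_recl ltr_pwDl ?S_term_gt0 // sumr_ge0 // => k _.
  exact/ltW/S_term_gt0.
have := tight_bound_S; rewrite ltnNge => le1; apply/negP => le5.
have {le5} : 6 <= n.+1%:R :> R by rewrite (ler_nat _ 6).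
have : n.+1%:R <= 16 :> R.
  rewrite (ler_nat _ _ 16); have := leq_card _ rho_inj.
  by rewrite card_ord card_mx card_Fp.
by move: le1; move: (n.+1%:R : R) => f; nra.
Qed.

(** Right-hand side of the system satisfied by z = (1 - X) / 2 on the free
    coordinates; off them z is 0 or 1, according as X is 1 or -1. *)
Let c i : int := 8 * (rho i == 0)%:R + 2
  - \sum_(j | j \notin codom gamma) int_sylvester (rho i) j * (X j == -1)%:R.
Let z : 'cV[R]_n.+1 := \col_k ((1 - X (gamma k)) / 2).

Lemma half_integer_system : map_mx intr M *m z = map_mx intr (\col_i c i).
Proof.
apply/colP => i; rewrite !mxE.
have := sum_sylvester R (rho i); rewrite sum_split_free.
under eq_bigr => k _ do rewrite sylvesterC.
under [X in _ + X = _]eq_bigr => k _ do rewrite sylvesterC.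
have := X_tight i; rewrite /walsh sum_split_free.
have fixedE j : j \notin codom gamma ->
    sylvester R (rho i) j * X j = sylvester R (rho i) j
     - 2 * (int_sylvester (rho i) j * (X j == -1)%:R)%:~R.
  move=> jF; rewrite intrM sylvesterE.
  have /eqP := X_fixed jF; rewrite eqr_norml ler01 andbT => /orP[]/eqP ->.
    rewrite (_ : (1 == -1 :> R) = false) ?mulr0 ?subr0 ?mulr1 //.
    by apply/eqP; lra.
  by rewrite eqxx [true%:R%:~R](_ : _ = 1 :> R) //; ring.
rewrite (eq_bigr _ fixedE) sumrB -mulr_sumr -rmorph_sum /=.
under [\sum_j (map_mx _ _) _ _ * _]eq_bigr => k _ do rewrite !mxE -sylvesterE.
have -> : \sum_k sylvester R (rho i) (gamma k) * ((1 - X (gamma k)) / 2)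
  = (\sum_k sylvester R (rho i) (gamma k)
     - \sum_k sylvester R (rho i) (gamma k) * X (gamma k)) / 2.
  by rewrite -sumrB mulr_suml; apply: eq_bigr => k _; ring.
have -> : (c i)%:~R = 8 * (rho i == 0)%:R + 2 - (\sum_(j | j \notin codom gamma)
    int_sylvester (rho i) j * (X j == -1)%:R)%:~R :> R.
  by rewrite /c intrB intrD intrM; case: (rho i == 0).
by lra.
Qed.

(** Signs are odd, so the parity of c i depends only on the number of fixed
    coordinates where X is -1. *)
Lemma c_congruent i : (2 %| c i - c ord0)%Z.
Proof.
have -> : c i - c ord0 = 2 * (4 * ((rho i == 0)%:R - (rho ord0 == 0)%:R))
    - \sum_(j | j \notin codom gamma)
      (int_sylvester (rho i) j - int_sylvester (rho ord0) j) * (X j == -1)%:R.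
  under [X in _ = _ - X]eq_bigr => j _ do rewrite mulrBl.
  by rewrite sumrB /c; ring.
rewrite rpredB //; first by rewrite dvdz_mulr.
apply: rpred_sum => j _; rewrite -[_ \in _]/(2 %| _)%Z dvdz_mulr //.
by apply: sign_mx_odd_sub; rewrite normr_int_sylvester.
Qed.

(** A fraction with denominator at most K strictly between 0 and 1 lies between
    1 / K and 1 - 1 / K; for K = 1 there is none. *)
Lemma z_bounds k : 1 <= (max_denominator n)%:~R * z k ord0 /\
  1 <= (max_denominator n)%:~R * (1 - z k ord0).
Proof.
have [|d [q [/andP[d0 dK] dz]]] := @sign_system_denominator R n M (\col_i c i) z
    few_free_coords sign_mx_tight _ half_integer_system detM k.
  by move=> i; rewrite !mxE c_congruent.
have [z0 z1] : 0 < z k ord0 /\ z k ord0 < 1.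
  by have := X_free k; rewrite !mxE ltr_norml => /andP[]; split; lra.
have d0R : 0 < d%:~R :> R by rewrite ltr0z.
have dKR : d%:~R <= (max_denominator n)%:~R :> R by rewrite ler_int.
have q1 : 1 <= q%:~R :> R.
  by rewrite (ler_int _ 1) -gtz0_ge1 -(ltr0z R) -dz mulr_gt0.
have qd : 1 <= d%:~R - q%:~R :> R.
  rewrite -intrB (ler_int _ 1) -gtz0_ge1 -(ltr0z R) intrB -dz.
  by rewrite -[X in X - _]mulr1 -mulrBr mulr_gt0 // subr_gt0.
by split; nra.
Qed.

Lemma four_free_coords : n = 3%N.
Proof.
have lt_n5 := few_free_coords.
have [le_n2|] := leqP n 2.
  exfalso; have [] := z_bounds ord0.
  have -> : max_denominator n = 1.
    by case: (n) le_n2 => [|[|[|]]].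
  by have := X_free ord0; rewrite !mxE ltr_norml => /andP[]; lra.
rewrite leq_eqVlt => /orP[/eqP <- //|lt3n].
have n4 : n = 4%N by apply/eqP; rewrite eqn_leq lt3n andbT -ltnS.
have S_ge : n.+1%:R * (3 / 4) <= S.
  rewrite mulr_natl -[X in _ *+ X](card_ord n.+1) -sumr_const /S.
  apply: ler_sum => k _; have [] := z_bounds k.
  by rewrite [max_denominator n](_ : _ = 4) ?n4 // !mxE; nra.
by exfalso; have := tight_bound_S; move: S_ge; rewrite n4; lra.
Qed.

End Tight.

(** With m = M^T 1, the vector Y equal to - m / 2 on the free coordinates and to
    X elsewhere satisfies |m|^2 = 1^T M M^T 1 = 16, hence |Y|^2 = 12 + 4, and
    (HY)_r = -4 - (M m)_r / 2 = -6 on the four rows.  The estimate for h = 6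
    would give 40^2 <= 12 (256 - 144) = 1344. *)
Lemma no_four_free_coords (R : realType) (X : V -> R) (rho gamma : 'I_4 -> V) :
    X 0 = 1 -> injective rho -> injective gamma ->
    (forall k, X (gamma k) = 0) ->
    (forall j, j \notin codom gamma -> `|X j| = 1) ->
    (forall i, walsh X (rho i) = -4) ->
    let M : 'M[int]_4 := \matrix_(i, k) int_sylvester (rho i) (gamma k) in
    \det M != 0 -> (forall i, (4 %| (\sum_j M i j) - \sum_j M ord0 j)%Z) ->
  False.
Proof.
move=> X0 rho_inj gamma_inj Xg Xf Xt M detM dvd4.
have sM : sign_mx M by move=> i k; rewrite mxE normr_int_sylvester.
have MMT := sign_rows_orthogonal sM dvd4 detM.
pose m : 'cV[int]_4 := M^T *m const_mx 1.
have Mm i : (M *m m) i ord0 = 4 by rewrite mulmxA MMT mul_scalar_mx !mxE mulr1.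
have mm : \sum_k m k ord0 ^+ 2 = 16.
  transitivity ((m^T *m m) ord0 ord0).
    by rewrite !mxE; apply: eq_bigr => k _; rewrite [m^T _ _]mxE expr2.
  rewrite /m trmx_mul trmxK -mulmxA (mulmxA M) MMT mul_scalar_mx !mxE.
  by rewrite (eq_bigr (fun=> 4)) ?sumr_const ?card_ord // => k _; rewrite !mxE.
have {}Mm i : \sum_k sylvester R (rho i) (gamma k) * (m k ord0)%:~R = 4.
  rewrite -[RHS](_ : 4%:~R = 4) // -(Mm i) mxE rmorph_sum /=.
  by apply: eq_bigr => k _; rewrite [M i k]mxE intrM sylvesterE.
pose Y j : R := X j - (\sum_k (j == gamma k)%:R * (m k ord0)%:~R) / 2.
have Yg k : Y (gamma k) = - (m k ord0)%:~R / 2.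
  rewrite /Y Xg (bigD1 k) //= eqxx mul1r big1 ?addr0 => [|l ne].
    by rewrite sub0r mulNr.
  by rewrite (inj_eq gamma_inj) eq_sym (negbTE ne) mul0r.
have Yf j : j \notin codom gamma -> Y j = X j.
  move=> jF; rewrite /Y big1 ?mul0r ?subr0 // => k _.
  rewrite (_ : (j == _) = false) ?mul0r //.
  by apply: contraNF jF => /eqP->; exact: codom_f.
have Y0 : Y 0 = 1.
  rewrite Yf //; apply/codomP => -[k g0]; have := Xg k.
  by rewrite -g0 X0 => /eqP; rewrite oner_eq0.
have := tight_bound rho_inj Y0 (h := 6).
rewrite (sum_split_free gamma_inj).
have <- : \sum_(j | j \notin codom gamma) 1 =
    \sum_(j | j \notin codom gamma) Y j ^+ 2.
  apply: eq_bigr => j jF.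
  by rewrite Yf // -real_normK ?num_real // Xf // expr1n.
have -> : \sum_k Y (gamma k) ^+ 2 = 4.
  under eq_bigr => k _ do rewrite Yg.
  have E : \sum_k ((m k ord0 ^+ 2)%:~R : R) = 16 by rewrite -rmorph_sum mm.
  transitivity ((\sum_k ((m k ord0 ^+ 2)%:~R : R)) / 4).
    rewrite mulr_suml; apply: eq_bigr => k _.
    by rewrite rmorphXn /=; field.
  by rewrite E; field.
have -> : \sum_(j | j \notin codom gamma) 1 = 12 :> R.
  have := sum_split_free gamma_inj (fun=> 1 : R).
  by rewrite !sumr_const card_mx card_Fp // card_ord; lra.
have wY i : walsh Y (rho i) = - 6.
  have := Xt i; rewrite /walsh !(sum_split_free gamma_inj).
  have -> : \sum_(j | j \notin codom gamma) sylvester R (rho i) j * Y j =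
     \sum_(j | j \notin codom gamma) sylvester R (rho i) j * X j.
    by apply: eq_bigr => j jF; rewrite Yf.
  rewrite big1 => [|k _]; last by rewrite Xg mulr0.
  have -> : \sum_k sylvester R (rho i) (gamma k) * Y (gamma k) = - 2.
    transitivity ((\sum_k sylvester R (rho i) (gamma k) * (m k ord0)%:~R) / -2).
      by rewrite mulr_suml; apply: eq_bigr => k _; rewrite Yg; field.
    by rewrite Mm; field.
  by lra.
by move=> /(_ wY); lra.
Qed.

(** The bounds on z leave z = 1/2, that is X = 0, at four free coordinates; the
    row sums of M are then the numbers 2 c i, congruent modulo 4. *)
Lemma no_free_coords (R : realType) n (X : V -> R) (rho gamma : 'I_n -> V) :
    X 0 = 1 -> injective rho -> injective gamma ->
    (forall k, `|X (gamma k)| < 1) ->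
    (forall j, j \notin codom gamma -> `|X j| = 1) ->
    (forall i, walsh X (rho i) = -4) ->
    \det (\matrix_(i, k) int_sylvester (rho i) (gamma k)) != 0 ->
  n = 0%N.
Proof.
case: n rho gamma => // n rho gamma X0 rho_inj gamma_inj Xg Xf Xt detM.
have n3 := four_free_coords X0 rho_inj gamma_inj Xg Xf Xt detM.
have zb := z_bounds X0 rho_inj gamma_inj Xg Xf Xt detM.
have cE := half_integer_system gamma_inj Xf Xt.
have cc := c_congruent X rho gamma.
subst n; set M := \matrix_(i, k) _ in detM cE.
have X0g k : X (gamma k) = 0.
  have [] := zb k; rewrite [max_denominator 3](_ : _ = 2) // !mxE.
  by move: (X (gamma k)) => ? ? ?; lra.
exfalso; apply: (no_four_free_coords X0 rho_inj gamma_inj X0g Xf Xt detM) => i.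
have rowE l : \sum_j M l j = 2 * (8 * (rho l == 0)%:R + 2
    - \sum_(j | j \notin codom gamma)
        int_sylvester (rho l) j * (X j == -1)%:R).
  apply: (@intr_inj R); have /colP/(_ l) := cE; rewrite !mxE => El.
  rewrite intrM -El mulr_sumr rmorph_sum /=; apply: eq_bigr => k _.
  by rewrite !mxE X0g; field.
by have := cc i; rewrite -/M !rowE; lia.
Qed.

Lemma vertex_sign (R : realType) (x : space15 R) :
  vertices (Pmn R 5 1) x -> forall j, `|ext x j| = 1.
Proof.
move=> xV; have [rho [rho_inj Xt detM]] := vertex_tight_rows xV.
have [x1 _] := (Pmn51P x).1 (proj1 xV).
have F_eq j : (j \in free_coords x) = (`|ext x j| < 1) by rewrite inE.
pose gamma (k : 'I_#|free_coords x|) : V := enum_val k.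
have gamma_inj : injective gamma by apply: enum_val_inj.
have Xg k : `|ext x (gamma k)| < 1 by rewrite -F_eq enum_valP.
have Xf j : j \notin codom gamma -> `|ext x j| = 1.
  move=> jF; apply/eqP; rewrite eq_le x1 leNgt -F_eq; apply: contra jF => jF.
  by apply/codomP; exists (enum_rank_in jF j); rewrite /gamma enum_rankK_in.
suff f0 : #|free_coords x| = 0%N.
  move=> j; apply/eqP; rewrite eq_le x1 leNgt -F_eq.
  by have /card0_eq -> := f0.
exact: (no_free_coords (ext0 x) rho_inj gamma_inj Xg Xf Xt detM).
Qed.

Lemma integral_Pmn51 (R : realType) : integral_in (Pmn R 5 1) (Lambda R 1).
Proof.
move=> x /vertex_sign x1 j; have := x1 (val j); rewrite ext_val.
move/eqP; rewrite eqr_norml ler01 andbT => /orP[]/eqP ->.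
  by exists 0; rewrite mulr0 addr0.
by exists (-1); rewrite rmorphN1; lra.
Qed.

(** * A lattice point of the doubled polytope that does not split *)

(** Coordinates on F_2^4 that compute, to evaluate transforms by enumeration. *)
Definition bits := (bool * bool * bool * bool)%type.

Definition vec (b : bits) : V :=
  let: (b0, b1, b2, b3) := b in
  \row_(i < 4) (nth false [:: b0; b1; b2; b3] i)%:R.

Definition unvec (j : V) : bits :=
  (j 0 0 != 0, j 0 1 != 0, j 0 2 != 0, j 0 3 != 0).

Lemma vecK : cancel vec unvec.
Proof.
case=> [[[b0 b1] b2] b3]; rewrite /unvec !mxE.
by case: b0 b1 b2 b3 => [] [] [] [].
Qed.

Lemma card_bits : #|{: bits}| = #|{: V}|.
Proof. by rewrite card_mx card_Fp // !card_prod card_bool. Qed.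

Lemma unvecK : cancel unvec vec.
Proof.
have vec_bij := inj_card_bij (can_inj vecK) (eq_leq (esym card_bits)).
exact/(bij_can_sym vec_bij)/vecK.
Qed.

Definition bsign (a b : bits) : int :=
  let: (a0, a1, a2, a3) := a in let: (b0, b1, b2, b3) := b in
  (-1) ^+ ((a0 && b0) (+) (a1 && b1) (+) (a2 && b2) (+) (a3 && b3)).

Lemma int_sylvester_vec a b : int_sylvester (vec a) (vec b) = bsign a b.
Proof.
case: a b => [[[a0 a1] a2] a3] [[[b0 b1] b2] b3].
have sgn (a b : bool) :
    (-1) ^+ nat_of_ord (a%:R * b%:R : 'F_2) = (-1) ^+ (a && b) :> int.
  by case: a b => [] [].
rewrite /int_sylvester /dotF2 !big_ord_recl big_ord0 !signF2D !mxE !sgn.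
by rewrite /= !signr_addb expr0 mulr1 !mulrA.
Qed.

(** Write j = (u, v) with u, v in F_2^2.  The value is the indicator of u = 0
    for v = 0, it is 1 for v = (1, 1), and for the other two v it is 1 unless
    u = 0, where it is -1.  With r = (s, t), the numbers ((Hy)_r + 3) / 4 form the
    table (3, 0, 0, 1) for s = 0 and (0, 1, 1, 2) for each s <> 0, where t runs
    through 00, 01, 10, 11.  The plane W is v = 0. *)
Definition midpoint (b : bits) : int :=
  let: (b0, b1, b2, b3) := b in
  if b2 && b3 then 1 else
  if b2 || b3 then (if b0 || b1 then 1 else -1) else (~~ (b0 || b1))%:R.

Definition int_walsh (f : bits -> int) (a : bits) : int :=
  \sum_b bsign a b * f b.

Lemma sum_bits (A : nmodType) (F : bits -> A) :
  \sum_b F b = \sum_b0 \sum_b1 \sum_b2 \sum_b3 F (b0, b1, b2, b3).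
Proof.
rewrite (pair_bigA _ (fun b0 b1 => \sum_b2 \sum_b3 F (b0, b1, b2, b3))) /=.
rewrite (pair_bigA _ (fun b b2 => \sum_b3 F (b.1, b.2, b2, b3))) /=.
rewrite (pair_bigA _ (fun b b3 => F (b.1.1, b.1.2, b.2, b3))) /=.
by apply: eq_bigr => [[[[b0 b1] b2] b3]].
Qed.

Lemma walsh_vec (R : realType) (X : V -> R) a :
  walsh X (vec a) = \sum_b (bsign a b)%:~R * X (vec b).
Proof.
rewrite /walsh (reindex vec) /=; last first.
  by exists unvec => ? _; [exact: vecK | exact: unvecK].
by apply: eq_bigr => b _; rewrite sylvesterE int_sylvester_vec.
Qed.

Lemma midpoint_walsh_ge a : -4 <= int_walsh midpoint a.
Proof.
by case: a => [[[[] []] []] []]; rewrite /int_walsh sum_bits !big_bool.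
Qed.

(** Each pair (b0, b1) is a character of W; the value -3 leaves only the
    slack 1 for a change of signs on W. *)
Lemma midpoint_walsh_small b0 b1 :
  int_walsh midpoint (b0, b1, false, ~~ (b0 || b1)) = -3.
Proof. by case: b0 b1 => [] []; rewrite /int_walsh sum_bits !big_bool. Qed.

(** With A and B the two summands and Y the midpoint, E = A - Y = Y - B vanishes
    off W \ 0 and is a choice of signs there.  At a row where HY is -3, the
    constraint on A bounds HE from below and the one on B bounds it from
    above; the four rows of [midpoint_walsh_small] cannot all hold. *)
Lemma not_normal_Pmn51 (R : realType) : ~ is_normal R 5 1.
Proof.
pose Y (j : V) : R := (midpoint (unvec j))%:~R.
have Y0 : Y 0 = 1 by rewrite /Y /unvec !mxE.
have Y_vec b : Y (vec b) = (midpoint b)%:~R by rewrite /Y vecK.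
have walshY a : walsh Y (vec a) = (int_walsh midpoint a)%:~R.
  rewrite walsh_vec rmorph_sum /=; apply: eq_bigr => b _.
  by rewrite Y_vec intrM.
have Y_val j : Y j = -1 \/ Y j = 0 \/ Y j = 1.
  rewrite /Y; case: (unvec j) => [[[[] []] []] []]; rewrite /= ?rmorphN1; tauto.
pose y : space15 R := [ffun k => Y (val k)].
have ext_y j : ext y j = Y j.
  have [->|j0] := eqVneq j 0; first by rewrite ext0 Y0.
  by rewrite -[j]/(val (Sub j j0 : index15)) ext_val ffunE.
have walsh_eq (A B : V -> R) r : (forall j, A j = B j) -> walsh A r = walsh B r.
  by move=> AB; apply: eq_bigr => j _; rewrite AB.
have yP : Pmn R 5 1 y.
  apply/Pmn51P; split=> [j|r]; rewrite ?ext_y.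
    by have := Y_val j; rewrite ler_norml; lra.
  rewrite (walsh_eq _ Y) // -[r]unvecK walshY.
  by rewrite (ler_int _ (-4)) midpoint_walsh_ge.
move=> normalP; have [||p [pP py]] := normalP 2 isT (2 *: y).
- by exists y.
- move=> j; rewrite !ffunE /GRing.scale /=.
  exists (midpoint (unvec (val j)) - 1); rewrite -/(Y _) intrB -/(Y _).
  by rewrite mulrBr mulr1 addrC subrK.
pose A := ext (p 0); pose B := ext (p 1).
have AB j : A j + B j = 2 * Y j.
  have [->|j0] := eqVneq j 0; first by rewrite /A /B !ext0 Y0; lra.
  rewrite -[j]/(val (Sub j j0 : index15)) /A /B !ext_val.
  have /ffunP/(_ (Sub j j0)) := py; rewrite !big_ord_recl big_ord0 addr0 !ffunE.
  by rewrite /GRing.scale /= => ->; congr (_ + p _ _); apply/val_inj.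
have [A1 A4] : (forall j, `|A j| <= 1) /\ (forall r, -4 <= walsh A r)
  := (Pmn51P _).1 (pP 0).1.
have [B1 B4] : (forall j, `|B j| <= 1) /\ (forall r, -4 <= walsh B r)
  := (Pmn51P _).1 (pP 1).1.
have A_odd j : A j = 1 \/ A j = -1.
  have [->|j0] := eqVneq j 0; first by left; rewrite /A ext0.
  have := A1 j; rewrite /A -[j]/(val (Sub j j0 : index15)) ext_val.
  have [q ->] := (pP 0).2 (Sub j j0); rewrite ler_norml => /andP[].
  rewrite -[-1]/((-1)%:~R) -[1]/(1%:~R) -[2]/(2%:~R) -intrM -intrD !ler_int.
  move=> q1 q2; have [->|->] : q = 0 \/ q = -1 by lia.
    by left.
  by right.
pose E j := A j - Y j.
have E0 j : Y j != 0 -> E j = 0.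
  have := A1 j; have := B1 j; have := AB j; rewrite !ler_norml /E.
  by case: (Y_val j) => [->|[->|->]]; rewrite ?eqxx //; lra.
have walshE r : walsh E r = walsh A r - walsh Y r.
  by rewrite /walsh -sumrB; apply: eq_bigr => j _; rewrite mulrBr.
have walsh_B r : walsh A r + walsh B r = 2 * walsh Y r.
  rewrite /walsh -big_split mulr_sumr; apply: eq_bigr => j _ /=.
  by rewrite -mulrDr AB mulrCA.
have tight b0 b1 : `|walsh E (vec (b0, b1, false, ~~ (b0 || b1)))| <= 1.
  have := walshY (b0, b1, false, ~~ (b0 || b1)); rewrite midpoint_walsh_small.
  move: (vec _) => r Yr; have := walsh_B r; have := A4 r; have := B4 r.
  by rewrite ler_norml walshE Yr; lra.
have Z b : midpoint b != 0 -> E (vec b) = 0.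
  by move=> b0; apply: E0; rewrite Y_vec intr_eq0.
have Z1 b0 b1 b3 : E (vec (b0, b1, true, b3)) = 0.
  by apply: Z; case: b0 b1 b3 => [] [] [].
have Z2 b0 b1 : E (vec (b0, b1, false, true)) = 0.
  by apply: Z; case: b0 b1 => [] [].
have Z3 : E (vec (false, false, false, false)) = 0 by apply: Z.
have E_odd b0 b1 : b0 || b1 ->
    E (vec (b0, b1, false, false)) = 1 \/ E (vec (b0, b1, false, false)) = -1.
  move=> b01; rewrite /E Y_vec /= b01 subr0; exact: A_odd.
move: (E_odd true true isT) (E_odd true false isT) (E_odd false true isT).
have := tight false false; have := tight true false.
have := tight false true; have := tight true true.
rewrite !walsh_vec !sum_bits !big_bool /= !Z1 !Z2 Z3 !ler_norml !expr0 !expr1.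
rewrite !rmorphN1 !mulr0 !add0r !addr0 !mul1r !mulN1r.
move=> /andP[? ?] /andP[? ?] /andP[? ?] /andP[? ?].
by case=> e11; case=> e10; case=> e01; lra.
Qed.

Theorem proposition3p3 (R : realType) :
  integral_in (Pmn R 5 1) (Lambda R 1) /\ ~ is_normal R 5 1.
Proof. by split; [exact: integral_Pmn51 | exact: not_normal_Pmn51]. Qed.
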